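(* Let $d\in\mathbb{N}$, let $H$ be a Hilbert space, let $\rho:\mathrm{Pol}(O_d^+)\to B(H)$ be a unital $^*$-representation, put $R=(\rho(u_{jk}))_{j,k=1}^d\in M_d(B(H))$, and let $V\in M_d(H)$. Then the following conditions are equivalent: (i) there is a $\rho$-$\epsilon$-cocycle $\eta$ on $\mathrm{Pol}(O_d^+)$ satisfying $V=(\eta(u_{jk}))_{j,k=1}^d$; (ii) $(R^*V)^t=\bar RV^t=-V$.
   Context: $\mathrm{Pol}(O_d^+)$ is the universal unital $^*$-algebra generated by selfadjoint elements $u_{jk}=u_{jk}^*$, $1\le j,k\le d$, subject to the relations that $u=(u_{jk})$ is unitary ($uu^*=u^*u=I$). Its character $\epsilon$ is the unital $^*$-homomorphism to $\mathbb{C}$ with $\epsilon(u_{jk})=\delta_{jk}$. A $\rho$-$\epsilon$-cocycle is a linear map $\eta:\mathrm{Pol}(O_d^+)\to H$ with $\eta(ab)=\rho(a)\eta(b)+\eta(a)\epsilon(b)$ for all $a,b$. Matrix conventions: $\bar R=(R_{jk}^* )_{j,k}$, $R^*=(R_{kj}^* )_{j,k}$; the transpose is $(X^t)_{jk}=X_{kj}$ for matrices over $B(H)$ or over $H$; for $X\in M_d(B(H))$ and $Y\in M_d(H)$, $(XY)_{jk}=\sum_{p=1}^dX_{jp}Y_{pk}\in H$. *)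

(* Defs.v *)
From HB Require Import structures.
From mathcomp Require Import all_boot all_order all_algebra.
From mathcomp Require Import complex.
From mathcomp Require Import all_classical all_reals.
From mathcomp Require Import topology normedtype.

Set Implicit Arguments.
Unset Strict Implicit.
Unset Printing Implicit Defensive.

Import Order.TTheory GRing.Theory Num.Theory.
Import numFieldNormedType.Exports.

Local Open Scope ring_scope.
Local Open Scope quotient_scope.

HB.mixin Record Algebra_hasStar (C : numClosedFieldType) A
    of GRing.Algebra C A := {
  star : A -> A;
  starK : involutive star;
  starD : {morph star : a b / a + b};
  starM : forall a b, star (a * b) = star b * star a;
  starZ : forall (c : C) a, star (c *: a) = c^* *: star a
}.

#[short(type="starAlgType")]
HB.structure Definition StarAlgebra (C : numClosedFieldType) :=
  {A of Algebra_hasStar C A & GRing.Algebra C A}.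

Section ScalarStar.
Variable C : numClosedFieldType.

Let conj_starD : {morph (fun a : C^o => a^* : C^o) : a b / a + b}.
Proof. by move=> a b; rewrite rmorphD. Qed.
Let conj_starM (a b : C^o) : ((a * b)^* : C^o) = b^* * a^*.
Proof. by rewrite rmorphM mulrC. Qed.
Let conj_starZ (c : C) (a : C^o) : ((c *: a)^* : C^o) = c^* *: (a^* : C^o).
Proof. by rewrite rmorphM. Qed.

HB.instance Definition _ := Algebra_hasStar.Build C C^o
  (@conjCK C : involutive (fun a : C^o => a^* : C^o))
  conj_starD conj_starM conj_starZ.

End ScalarStar.

Section StarLemmas.
Variables (C : numClosedFieldType) (A : starAlgType C).

Lemma star0 : star (0 : A) = 0.
Proof. by apply: (addrI (star 0)); rewrite -starD !addr0. Qed.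

Lemma star1 : star (1 : A) = 1.
Proof. by rewrite -[LHS]mulr1 -{2}(starK 1) -starM mulr1 starK. Qed.

Definition starmx d (v : 'M[A]_d) : 'M[A]_d := \matrix_(j, k) star (v k j).

Definition orthogonal_gens d (v : 'M[A]_d) :=
  [/\ forall j k, star (v j k) = v j k,
      v *m starmx v = 1%:M & starmx v *m v = 1%:M].

End StarLemmas.

(* Pol(O_d^+) is built as the terms of the language of unital *-algebras in the
   generators, modulo the least congruence containing the unital *-algebra
   axioms and the defining relations; pol_universal below is its universal
   property. *)
Inductive pterm (C : Type) (d : nat) : Type :=
| PGen of 'I_d & 'I_d
| PZero
| POne
| POpp of pterm C d
| PAdd of pterm C d & pterm C d
| PMul of pterm C d & pterm C d
| PScale of C & pterm C d
| PStar of pterm C d.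

Arguments PGen {C d}.
Arguments PZero {C d}.
Arguments POne {C d}.

HB.instance Definition _ (C : Type) d := gen_eqMixin (pterm C d).
HB.instance Definition _ (C : Type) d := gen_choiceMixin (pterm C d).

Section PolDef.
Variables (C : numClosedFieldType) (d : nat).

Local Notation T := (pterm C d).
Local Notation "a +t b" := (PAdd a b) (at level 50, left associativity).
Local Notation "a *t b" := (PMul a b) (at level 40, left associativity).

Inductive pcong : T -> T -> Prop :=
| PC_refl a : pcong a a
| PC_sym a b : pcong a b -> pcong b a
| PC_trans a b c : pcong a b -> pcong b c -> pcong a c
| PC_opp a b : pcong a b -> pcong (POpp a) (POpp b)
| PC_add a a' b b' : pcong a a' -> pcong b b' -> pcong (a +t b) (a' +t b')
| PC_mul a a' b b' : pcong a a' -> pcong b b' -> pcong (a *t b) (a' *t b')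
| PC_scale c a b : pcong a b -> pcong (PScale c a) (PScale c b)
| PC_star a b : pcong a b -> pcong (PStar a) (PStar b)
| PC_addA a b c : pcong (a +t (b +t c)) (a +t b +t c)
| PC_addC a b : pcong (a +t b) (b +t a)
| PC_add0 a : pcong (PZero +t a) a
| PC_addN a : pcong (POpp a +t a) PZero
| PC_mulA a b c : pcong (a *t (b *t c)) (a *t b *t c)
| PC_1mul a : pcong (POne *t a) a
| PC_mul1 a : pcong (a *t POne) a
| PC_mulDl a b c : pcong ((a +t b) *t c) (a *t c +t b *t c)
| PC_mulDr a b c : pcong (a *t (b +t c)) (a *t b +t a *t c)
| PC_scaleA x y a : pcong (PScale x (PScale y a)) (PScale (x * y) a)
| PC_scale1 a : pcong (PScale 1 a) a
| PC_scaleDr x a b : pcong (PScale x (a +t b)) (PScale x a +t PScale x b)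
| PC_scaleDl x y a : pcong (PScale (x + y) a) (PScale x a +t PScale y a)
| PC_scaleAl x a b : pcong (PScale x (a *t b)) (PScale x a *t b)
| PC_scaleAr x a b : pcong (PScale x (a *t b)) (a *t PScale x b)
| PC_starK a : pcong (PStar (PStar a)) a
| PC_starD a b : pcong (PStar (a +t b)) (PStar a +t PStar b)
| PC_starM a b : pcong (PStar (a *t b)) (PStar b *t PStar a)
| PC_starZ x a : pcong (PStar (PScale x a)) (PScale x^* (PStar a))
| PC_selfadjoint j k : pcong (PStar (PGen j k)) (PGen j k)
| PC_mul_star j k :
    pcong (\big[@PAdd C d/PZero]_(p < d) (PGen j p *t PStar (PGen k p)))
          (if j == k then POne else PZero)
| PC_star_mul j k :
    pcong (\big[@PAdd C d/PZero]_(p < d) (PStar (PGen p j) *t PGen p k))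
          (if j == k then POne else PZero).

Definition pcongb : rel T := fun a b => `[< pcong a b >].

Lemma pcongb_refl : reflexive pcongb.
Proof. by move=> a; apply/asboolP; exact: PC_refl. Qed.
Lemma pcongb_sym : symmetric pcongb.
Proof. by move=> a b; apply/asboolP/asboolP; exact: PC_sym. Qed.
Lemma pcongb_trans : transitive pcongb.
Proof. by move=> b a c /asboolP ab /asboolP bc; apply/asboolP/(PC_trans ab). Qed.

Canonical pcong_equiv := EquivRel pcongb pcongb_refl pcongb_sym pcongb_trans.

Definition Pol : Type := {eq_quot pcong_equiv}.
HB.instance Definition _ := Choice.on Pol.
HB.instance Definition _ := Quotient.on Pol.

Definition polpi (a : T) : Pol := \pi_Pol a.

Lemma polpiP a b : polpi a = polpi b <-> pcong a b.
Proof.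
split=> [|ab]; first by move/eqmodP/asboolP.
by apply/eqmodP/asboolP.
Qed.

Lemma polreprK : cancel (fun x : Pol => repr x) polpi.
Proof. by move=> x; exact: reprK. Qed.

Lemma pcong_repr a : pcong (repr (polpi a)) a.
Proof. by apply/polpiP; rewrite polreprK. Qed.

Lemma polW (P : Pol -> Prop) : (forall a, P (polpi a)) -> forall x, P x.
Proof. by move=> Ppi x; rewrite -(polreprK x). Qed.

Definition pol_opp (x : Pol) := polpi (POpp (repr x)).
Definition pol_add (x y : Pol) := polpi (repr x +t repr y).
Definition pol_mul (x y : Pol) := polpi (repr x *t repr y).
Definition pol_scale c (x : Pol) := polpi (PScale c (repr x)).
Definition pol_star (x : Pol) := polpi (PStar (repr x)).

Lemma pol_oppE a : pol_opp (polpi a) = polpi (POpp a).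
Proof. by apply/polpiP/PC_opp/pcong_repr. Qed.
Lemma pol_addE a b : pol_add (polpi a) (polpi b) = polpi (a +t b).
Proof. by apply/polpiP/PC_add; exact: pcong_repr. Qed.
Lemma pol_mulE a b : pol_mul (polpi a) (polpi b) = polpi (a *t b).
Proof. by apply/polpiP/PC_mul; exact: pcong_repr. Qed.
Lemma pol_scaleE c a : pol_scale c (polpi a) = polpi (PScale c a).
Proof. by apply/polpiP/PC_scale/pcong_repr. Qed.
Lemma pol_starE a : pol_star (polpi a) = polpi (PStar a).
Proof. by apply/polpiP/PC_star/pcong_repr. Qed.

Let polE := (pol_oppE, pol_addE, pol_mulE, pol_scaleE, pol_starE).

Ltac pol_law law :=
  repeat (elim/polW=> ?); rewrite ?polE; apply/polpiP; exact: law.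

Lemma pol_addA : associative pol_add. Proof. pol_law PC_addA. Qed.
Lemma pol_addC : commutative pol_add. Proof. pol_law PC_addC. Qed.
Lemma pol_add0 : left_id (polpi PZero) pol_add. Proof. pol_law PC_add0. Qed.
Lemma pol_addN : left_inverse (polpi PZero) pol_opp pol_add.
Proof. pol_law PC_addN. Qed.

HB.instance Definition _ :=
  GRing.isZmodule.Build Pol pol_addA pol_addC pol_add0 pol_addN.

Section Eval.
Variables (A : starAlgType C) (v : 'M[A]_d).

Fixpoint peval (t : T) : A :=
  match t with
  | PGen j k => v j k
  | PZero => 0
  | POne => 1
  | POpp a => - peval a
  | PAdd a b => peval a + peval b
  | PMul a b => peval a * peval b
  | PScale c a => c *: peval a
  | PStar a => star (peval a)
  end.

Lemma peval_sum (F : 'I_d -> T) :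
  peval (\big[@PAdd C d/PZero]_(p < d) F p) = \sum_(p < d) peval (F p).
Proof. exact: (big_morph peval). Qed.

Lemma peval_delta j k :
  peval (if j == k :> 'I_d then POne else PZero) = (j == k)%:R.
Proof. by case: eqP. Qed.

Lemma peval_cong a b : orthogonal_gens v -> pcong a b -> peval a = peval b.
Proof.
move=> [vS vvs vsv]; elim=> //=; try by move=> *; congruence.
- by move=> *; rewrite addrA.
- by move=> *; rewrite addrC.
- by move=> *; rewrite add0r.
- by move=> *; rewrite addNr.
- by move=> *; rewrite mulrA.
- by move=> *; rewrite mul1r.
- by move=> *; rewrite mulr1.
- by move=> *; rewrite mulrDl.
- by move=> *; rewrite mulrDr.
- by move=> *; rewrite scalerA.
- by move=> *; rewrite scale1r.
- by move=> *; rewrite scalerDr.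
- by move=> *; rewrite scalerDl.
- by move=> *; rewrite scalerAl.
- by move=> *; rewrite scalerAr.
- by move=> *; rewrite starK.
- by move=> *; rewrite starD.
- by move=> *; rewrite starM.
- by move=> *; rewrite starZ.
- move=> j k; rewrite peval_sum peval_delta.
  move/matrixP: vvs => /(_ j k); rewrite !mxE => <-.
  by apply: eq_bigr => p _; rewrite !mxE.
- move=> j k; rewrite peval_sum peval_delta.
  move/matrixP: vsv => /(_ j k); rewrite !mxE => <-.
  by apply: eq_bigr => p _; rewrite !mxE.
Qed.

End Eval.

Lemma id_orthogonal_gens : orthogonal_gens (1%:M : 'M[C^o]_d).
Proof.
have s1 : starmx (1%:M : 'M[C^o]_d) = 1%:M.
  apply/matrixP=> j k; rewrite !mxE eq_sym.
  by case: eqP => _; rewrite ?star1 ?star0.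
split; rewrite ?s1 ?mulmx1 // => j k; rewrite !mxE.
by case: eqP => _; rewrite ?star1 ?star0.
Qed.

Lemma pol_mulA : associative pol_mul. Proof. pol_law PC_mulA. Qed.
Lemma pol_1mul : left_id (polpi POne) pol_mul. Proof. pol_law PC_1mul. Qed.
Lemma pol_mul1 : right_id (polpi POne) pol_mul. Proof. pol_law PC_mul1. Qed.
Lemma pol_mulDl : left_distributive pol_mul pol_add.
Proof. pol_law PC_mulDl. Qed.
Lemma pol_mulDr : right_distributive pol_mul pol_add.
Proof. pol_law PC_mulDr. Qed.
Lemma pol_1neq0 : polpi POne != 0.
Proof.
apply/eqP=> /polpiP /(peval_cong id_orthogonal_gens) /= /eqP.
by rewrite oner_eq0.
Qed.

HB.instance Definition _ := GRing.Zmodule_isNzRing.Build Pol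
  pol_mulA pol_1mul pol_mul1 pol_mulDl pol_mulDr pol_1neq0.

Lemma pol_scaleA x y a : pol_scale x (pol_scale y a) = pol_scale (x * y) a.
Proof. by move: a; pol_law PC_scaleA. Qed.
Lemma pol_scale1 : left_id 1 pol_scale. Proof. pol_law PC_scale1. Qed.
Lemma pol_scaleDr : right_distributive pol_scale pol_add.
Proof. by move=> c; pol_law PC_scaleDr. Qed.
Lemma pol_scaleDl a x y :
  pol_scale (x + y) a = pol_add (pol_scale x a) (pol_scale y a).
Proof. by move: a; pol_law PC_scaleDl. Qed.

HB.instance Definition _ := GRing.Zmodule_isLmodule.Build C Pol
  pol_scaleA pol_scale1 pol_scaleDr pol_scaleDl.

Lemma pol_scaleAl c x y :
  pol_scale c (pol_mul x y) = pol_mul (pol_scale c x) y.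
Proof. by move: x y; pol_law PC_scaleAl. Qed.
HB.instance Definition _ := GRing.Lmodule_isLalgebra.Build C Pol pol_scaleAl.

Lemma pol_scaleAr c x y :
  pol_scale c (pol_mul x y) = pol_mul x (pol_scale c y).
Proof. by move: x y; pol_law PC_scaleAr. Qed.
HB.instance Definition _ := GRing.Lalgebra_isAlgebra.Build C Pol pol_scaleAr.

Lemma pol_starK : involutive pol_star. Proof. pol_law PC_starK. Qed.
Lemma pol_starD : {morph pol_star : a b / pol_add a b}. Proof. pol_law PC_starD. Qed.
Lemma pol_starM a b : pol_star (pol_mul a b) = pol_mul (pol_star b) (pol_star a).
Proof. by move: a b; pol_law PC_starM. Qed.
Lemma pol_starZ c a : pol_star (pol_scale c a) = pol_scale c^* (pol_star a).
Proof. by move: a; pol_law PC_starZ. Qed.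

HB.instance Definition _ := Algebra_hasStar.Build C Pol
  pol_starK pol_starD pol_starM pol_starZ.

Definition gen_mx : 'M[Pol]_d := \matrix_(j, k) polpi (PGen j k).

Lemma polpi_sum (F : 'I_d -> T) :
  polpi (\big[@PAdd C d/PZero]_(p < d) F p) = \sum_(p < d) polpi (F p).
Proof. by apply: (big_morph polpi) => // a b; rewrite -pol_addE. Qed.

Lemma gen_mx_orthogonal : orthogonal_gens gen_mx.
Proof.
have gE j k : gen_mx j k = polpi (PGen j k) by rewrite mxE.
have sE j k : star (gen_mx j k) = polpi (PStar (PGen j k)).
  by rewrite gE -pol_starE.
have dE (j k : 'I_d) :
    (j == k)%:R = polpi (if j == k then POne else PZero) :> Pol.
  by case: eqP.
split=> [j k||].
- by rewrite sE gE; apply/polpiP; exact: PC_selfadjoint.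
- apply/matrixP=> j k; rewrite [LHS]mxE [RHS]mxE dE.
  transitivity (polpi
      (\big[@PAdd C d/PZero]_(p < d) (PGen j p *t PStar (PGen k p)))).
    rewrite polpi_sum; apply: eq_bigr => p _.
    by rewrite [starmx _ _ _]mxE sE gE -pol_mulE.
  by apply/polpiP; exact: PC_mul_star.
- apply/matrixP=> j k; rewrite [LHS]mxE [RHS]mxE dE.
  transitivity (polpi
      (\big[@PAdd C d/PZero]_(p < d) (PStar (PGen p j) *t PGen p k))).
    rewrite polpi_sum; apply: eq_bigr => p _.
    by rewrite [starmx _ _ _]mxE sE gE -pol_mulE.
  by apply/polpiP; exact: PC_star_mul.
Qed.

Definition pol_lift (A : starAlgType C) (v : 'M[A]_d) (x : Pol) : A :=
  peval v (repr x).

Lemma pol_liftE (A : starAlgType C) (v : 'M[A]_d) :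
  orthogonal_gens v -> forall a, pol_lift v (polpi a) = peval v a.
Proof. by move=> vO a; exact/peval_cong/pcong_repr. Qed.

Definition unital_star_hom (A : starAlgType C) (f : Pol -> A) :=
  [/\ linear f, f 1 = 1, {morph f : a b / a * b}
    & {morph f : a / star a}].

Lemma pol_liftP (A : starAlgType C) (v : 'M[A]_d) : orthogonal_gens v ->
  unital_star_hom (pol_lift v) /\ map_mx (pol_lift v) gen_mx = v.
Proof.
move=> vO; have E := pol_liftE vO.
split; last by apply/matrixP=> j k; rewrite !mxE E.
split.
- move=> c; elim/polW=> a; elim/polW=> b.
  have -> : c *: polpi a + polpi b = polpi (PScale c a +t b).
    by rewrite -pol_addE -pol_scaleE.
  by rewrite !E.
- by rewrite E.
- elim/polW=> a; elim/polW=> b.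
  have -> : polpi a * polpi b = polpi (a *t b) by rewrite -pol_mulE.
  by rewrite !E.
- elim/polW=> a.
  have -> : star (polpi a) = polpi (PStar a) by rewrite -pol_starE.
  by rewrite !E.
Qed.

Lemma pol_lift_unique (A : starAlgType C) (f g : Pol -> A) :
  unital_star_hom f -> unital_star_hom g ->
  map_mx f gen_mx = map_mx g gen_mx -> f =1 g.
Proof.
move=> [fl f1 fM fS] [gl g1 gM gS] /matrixP fg.
have Z (h : Pol -> A) : linear h -> h 0 = 0.
  by move=> hl; have := hl (-1) 0 0; rewrite scaler0 addr0 scaleN1r addNr.
have S (h : Pol -> A) : linear h -> forall c a, h (c *: a) = c *: h a.
  by move=> hl c a; have := hl c a 0; rewrite Z // !addr0.
elim/polW; elim=> [j k|||a IH|a IHa b IHb|a IHa b IHb|c a IH|a IH].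
- by have := fg j k; rewrite !mxE.
- by rewrite -[polpi _]/(0 : Pol) !Z.
- by rewrite -[polpi _]/(1 : Pol) f1.
- have -> : polpi (POpp a) = (-1) *: polpi a by rewrite scaleN1r -pol_oppE.
  by rewrite !S // IH.
- have -> : polpi (a +t b) = 1 *: polpi a + polpi b.
    by rewrite scale1r -pol_addE.
  by rewrite fl gl IHa IHb.
- have -> : polpi (a *t b) = polpi a * polpi b by rewrite -pol_mulE.
  by rewrite fM gM IHa IHb.
- have -> : polpi (PScale c a) = c *: polpi a by rewrite -pol_scaleE.
  by rewrite !S // IH.
- have -> : polpi (PStar a) = star (polpi a) by rewrite -pol_starE.
  by rewrite fS gS IH.
Qed.

Theorem pol_universal (A : starAlgType C) (v : 'M[A]_d) : orthogonal_gens v ->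
  exists! f : Pol -> A, unital_star_hom f /\ map_mx f gen_mx = v.
Proof.
move=> vO; exists (pol_lift v); split=> [|g [gH gv]]; first exact: pol_liftP.
have [lH lv] := pol_liftP vO.
by apply/funext; apply: pol_lift_unique => //; rewrite lv gv.
Qed.

Definition counit : Pol -> C := pol_lift (1%:M : 'M[C^o]_d).

Lemma counitP : unital_star_hom (counit : Pol -> C^o) /\
  forall j k, counit (gen_mx j k) = (j == k)%:R.
Proof.
have [eH /matrixP ev] := pol_liftP id_orthogonal_gens.
by split=> // j k; have := ev j k; rewrite !mxE.
Qed.

End PolDef.

(* A {dot _ for Num.conj} form is linear in its first argument. *)
HB.mixin Record CompleteNormedModule_isHilbert (C : numClosedFieldType) H
    of CompleteNormedModule C H := {
  inner : {dot H for Num.conj};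
  sqr_norm_inner : forall x : H, `|x| ^+ 2 = inner x x
}.

#[short(type="hilbertType")]
HB.structure Definition Hilbert (C : numClosedFieldType) :=
  {H of CompleteNormedModule_isHilbert C H & CompleteNormedModule C H}.

Section Operators.
Variables (C : numClosedFieldType) (H : hilbertType C).

Record bop : Type := Bop {
  bop_fun :> {linear H -> H};
  bop_bounded : exists M : C, forall x, `|bop_fun x| <= M * `|x|
}.

HB.instance Definition _ := gen_eqMixin bop.
HB.instance Definition _ := gen_choiceMixin bop.

Definition is_adjoint (S T : bop) := forall x y, inner (T x) y = inner x (S y).

(* The default value is never used: by the Riesz representation theorem every
   bounded operator on a Hilbert space has an adjoint. *)
Definition adjoint (T : bop) : bop := xget T [set S | is_adjoint S T].

Lemma is_adjoint_uniq (S S' T : bop) :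
  is_adjoint S T -> is_adjoint S' T -> S =1 S'.
Proof.
move=> ST S'T y; apply/eqP; rewrite -subr_eq0 -normr_eq0 -sqrf_eq0.
by rewrite sqr_norm_inner linearBr /= -ST -S'T subrr.
Qed.

Lemma adjointP (S T : bop) : is_adjoint S T -> is_adjoint (adjoint T) T.
Proof. by move=> ST; rewrite /adjoint; case: xgetP => [? _ //|/(_ S)]. Qed.

Section OperatorMatrices.
Variable d : nat.

Definition op_mulmx (X : 'M[bop]_d) (Y : 'M[H]_d) : 'M[H]_d :=
  \matrix_(j, k) \sum_(p < d) X j p (Y p k).

Definition op_conjmx (X : 'M[bop]_d) : 'M[bop]_d :=
  \matrix_(j, k) adjoint (X j k).

Definition op_adjmx (X : 'M[bop]_d) : 'M[bop]_d :=
  \matrix_(j, k) adjoint (X k j).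

End OperatorMatrices.

Record unital_star_rep (A : starAlgType C) (rho : A -> bop) : Prop := {
  rep_linear : forall c a b x, rho (c *: a + b) x = c *: rho a x + rho b x;
  rep_one : forall x, rho 1 x = x;
  rep_mul : forall a b x, rho (a * b) x = rho a (rho b x);
  rep_star : forall a, is_adjoint (rho (star a)) (rho a)
}.

(* Scalars act on the left of H, so eta(a)eps(b) is written eps b *: eta a. *)
Definition is_cocycle (A : starAlgType C) (rho : A -> bop) (eps : A -> C)
    (eta : {linear A -> H}) :=
  forall a b, eta (a * b) = rho a (eta b) + eps b *: eta a.

End Operators.

(* Main.v *)
Require Import Defs.
From HB Require Import structures.
From mathcomp Require Import all_boot all_order all_algebra.
From mathcomp Require Import complex.
From mathcomp Require Import all_classical all_reals.
From mathcomp Require Import topology normedtype.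

(** A cocycle vanishes at 1, so applying it to the entries of [u u^* = 1] and
    [u^* u = 1] yields the two identities for [V]. Conversely, the cocycle rule
    determines [eta] on every term of the free unital *-algebra, and the two
    identities say precisely that the result respects unitarity of [u]. As
    [eta (star a)] is not a function of [eta a], the recursion on terms
    computes [eta a] and [eta (star a)] simultaneously. *)

Set Implicit Arguments.
Unset Strict Implicit.
Unset Printing Implicit Defensive.

Import GRing.Theory Num.Theory.

Local Open Scope ring_scope.

(** * The counit as a character with value the identity matrix on the generators *)

Section Counit.
Variables (C : numClosedFieldType) (d : nat).

Lemma counitD (a b : Pol C d) : counit (a + b) = counit a + counit b.
Proof.
by have [[l _ _ _] _] := counitP C d; have := l 1 a b; rewrite !scale1r.
Qed.

Lemma counitZ c (a : Pol C d) : counit (c *: a) = c * counit a.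
Proof.
have [[l _ _ _] _] := counitP C d.
have e0 : @counit C d 0 = 0.
  by have := l (-1) 0 0; rewrite scaler0 addr0 scaleN1r addNr.
by have := l c a 0; rewrite !addr0 e0 addr0.
Qed.

Lemma counitM (a b : Pol C d) : counit (a * b) = counit a * counit b.
Proof. by have [[_ _ m _] _] := counitP C d. Qed.

Lemma counit1 : @counit C d 1 = 1.
Proof. by have [[_ e _ _] _] := counitP C d. Qed.

Lemma counit_gen j k : counit (gen_mx C d j k) = (j == k)%:R.
Proof. by have [_] := counitP C d. Qed.

(** The counit of [u] is the identity matrix, so one summand survives. This collapses the counit
    half of the cocycle rule summed over a unitarity relation. *)
Lemma sum_counit_genr (H : lmodType C) (F : 'I_d -> H) k :
  \sum_(p < d) counit (gen_mx C d k p) *: F p = F k.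
Proof.
rewrite (bigD1 k) //= counit_gen eqxx scale1r big1 ?addr0 // => p pk.
by rewrite counit_gen eq_sym (negbTE pk) scale0r.
Qed.

Lemma sum_counit_genl (H : lmodType C) (F : 'I_d -> H) k :
  \sum_(p < d) counit (gen_mx C d p k) *: F p = F k.
Proof.
rewrite (bigD1 k) //= counit_gen eqxx scale1r big1 ?addr0 // => p pk.
by rewrite counit_gen (negbTE pk) scale0r.
Qed.

End Counit.

(** * Classes of terms and the unitarity relations, with stars removed by self-adjointness *)

Section PolOperations.
Variables (C : numClosedFieldType) (d : nat).
Implicit Types a b : pterm C d.

Lemma polpi_gen j k : polpi (PGen j k) = gen_mx C d j k.
Proof. by rewrite mxE. Qed.
Lemma polpi1 : polpi POne = 1 :> Pol C d. Proof. by []. Qed.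
Lemma polpiD a b : polpi (PAdd a b) = polpi a + polpi b.
Proof. by rewrite -pol_addE. Qed.
Lemma polpiM a b : polpi (PMul a b) = polpi a * polpi b.
Proof. by rewrite -pol_mulE. Qed.
Lemma polpiZ c a : polpi (PScale c a) = c *: polpi a.
Proof. by rewrite -pol_scaleE. Qed.
Lemma polpi_star a : polpi (PStar a) = star (polpi a).
Proof. by rewrite -pol_starE. Qed.

Lemma star_gen j k : star (gen_mx C d j k) = gen_mx C d j k.
Proof. by have [] := gen_mx_orthogonal C d. Qed.

Definition polpiE :=
  (polpi_gen, polpi1, polpiD, polpiM, polpiZ, polpi_star).

Lemma sum_gen_row j k :
  \sum_(p < d) gen_mx C d j p * gen_mx C d k p = (j == k)%:R.
Proof.
have [_ /matrixP/(_ j k) e _] := gen_mx_orthogonal C d; move: e.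
rewrite [LHS]mxE [RHS]mxE => <-; apply: eq_bigr => p _.
by rewrite [starmx _ _ _]mxE star_gen.
Qed.

Lemma sum_gen_col j k :
  \sum_(p < d) gen_mx C d p j * gen_mx C d p k = (j == k)%:R.
Proof.
have [_ _ /matrixP/(_ j k) e] := gen_mx_orthogonal C d; move: e.
rewrite [LHS]mxE [RHS]mxE => <-; apply: eq_bigr => p _.
by rewrite [starmx _ _ _]mxE star_gen.
Qed.

End PolOperations.

(** * Representations and their adjoints *)

Section Representation.
Variables (C : numClosedFieldType) (H : hilbertType C) (A : starAlgType C).
Variables (rho : A -> bop H) (hrho : unital_star_rep rho).

Lemma bopD (T : bop H) x y : T (x + y) = T x + T y.
Proof. exact: linearD. Qed.
Lemma bopZ (T : bop H) c x : T (c *: x) = c *: T x.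
Proof. exact: linearZ_LR. Qed.
Lemma bop0 (T : bop H) : T 0 = 0.
Proof. exact: linear0. Qed.

Lemma repD a b x : rho (a + b) x = rho a x + rho b x.
Proof. by rewrite -[a]scale1r (rep_linear hrho) !scale1r. Qed.

Lemma rep0 x : rho 0 x = 0.
Proof. by apply: (addrI (rho 0 x)); rewrite -repD !addr0. Qed.

Lemma repZ c a x : rho (c *: a) x = c *: rho a x.
Proof. by rewrite -[c *: a]addr0 (rep_linear hrho) rep0 addr0. Qed.

(** [rho (star a)] is an adjoint of [rho a], so [adjoint] selects a genuine adjoint, and adjoints
    are unique. *)
Lemma rep_adjoint a : adjoint (rho a) =1 rho (star a).
Proof.
apply: is_adjoint_uniq; last exact: (rep_star hrho).
exact: adjointP (rep_star hrho a).
Qed.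

End Representation.

Section Cocycle.
Variables (C : numClosedFieldType) (d : nat) (H : hilbertType C).
Variables (rho : Pol C d -> bop H) (hrho : unital_star_rep rho).
Local Notation u := (gen_mx C d).

(** * Necessity: identities forced on the values of a cocycle *)

Section Values.
Variable eta : {linear Pol C d -> H}.
Hypothesis etaP : is_cocycle rho (@counit C d) eta.

Lemma cocycle1 : eta 1 = 0.
Proof.
have := etaP 1 1; rewrite mulr1 (rep_one hrho) counit1 scale1r => e.
by apply: (addrI (eta 1)); rewrite addr0.
Qed.

Lemma cocycle_delta (j k : 'I_d) : eta (j == k)%:R = 0.
Proof. by case: eqP => _; rewrite ?cocycle1 ?linear0. Qed.

Lemma cocycle_row j k : \sum_(p < d) rho (u j p) (eta (u k p)) = - eta (u j k).
Proof.
apply/eqP; rewrite -addr_eq0.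
(* Writing [eta (u j k)] as a counit-weighted sum lets the two sums merge termwise into
   [eta (u j p * u k p)]. *)
rewrite -[X in _ + X](sum_counit_genr (fun p => eta (u j p))).
rewrite -big_split /=; apply/eqP; rewrite -[RHS](cocycle_delta j k).
by rewrite -sum_gen_row linear_sum; apply: eq_bigr => p _; rewrite etaP.
Qed.

Lemma cocycle_col j k : \sum_(p < d) rho (u p k) (eta (u p j)) = - eta (u j k).
Proof.
apply/eqP; rewrite -addr_eq0.
rewrite -[X in _ + X](sum_counit_genl (fun p => eta (u p k))).
(* The products are [u p k * u p j], so the relation used is the [(k, j)] entry of [u^* u]. *)
rewrite -big_split /=; apply/eqP; rewrite -[RHS](cocycle_delta k j).
by rewrite -sum_gen_col linear_sum; apply: eq_bigr => p _; rewrite etaP.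
Qed.

End Values.

(** * Sufficiency: a cocycle built by recursion on terms *)

Section Construction.
Variable V : 'M[H]_d.
Hypothesis rowV : forall j k, \sum_(p < d) rho (u j p) (V k p) = - V j k.
Hypothesis colV : forall j k, \sum_(p < d) rho (u p k) (V p j) = - V j k.

(* [cocycle_eval false t] is the value at [t], [cocycle_eval true t] the value
   at the adjoint of [t]. *)
Fixpoint cocycle_eval (s : bool) (t : pterm C d) : H :=
  match t with
  | PGen j k => V j k
  | PZero => 0
  | POne => 0
  | POpp a => - cocycle_eval s a
  | PAdd a b => cocycle_eval s a + cocycle_eval s b
  | PMul a b =>
      if s then rho (star (polpi b)) (cocycle_eval s a)
                + counit (star (polpi a)) *: cocycle_eval s b
      else rho (polpi a) (cocycle_eval s b)
           + counit (polpi b) *: cocycle_eval s a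
  | PScale c a => (if s then c^* else c) *: cocycle_eval s a
  | PStar a => cocycle_eval (~~ s) a
  end.

Lemma cocycle_eval_sum s (F : 'I_d -> pterm C d) :
  cocycle_eval s (\big[@PAdd C d/PZero]_(p < d) F p)
  = \sum_(p < d) cocycle_eval s (F p).
Proof. exact: (big_morph (cocycle_eval s)). Qed.

Lemma cocycle_eval_delta s (j k : 'I_d) :
  cocycle_eval s (if j == k then POne else PZero) = 0.
Proof. by case: eqP. Qed.

(** Induction on the congruence for both values of [s], since stars flip it. The algebra axioms
    follow from those of [rho] and [counit], self-adjointness from the generator clause ignoring
    [s], and unitarity from [rowV] and [colV]. *)
Lemma cocycle_eval_cong s a b :
  pcong a b -> cocycle_eval s a = cocycle_eval s b.
Proof.
move=> ab; elim: ab s => {a b} /=; try by move=> *; congruence.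
(* The product clause also involves the classes of the factors, so congruence is needed as equality
   in the quotient too. *)
- move=> a a' b b' /polpiP ea IHa /polpiP eb IHb s.
  by rewrite IHa IHb ea eb.
- by move=> *; rewrite addrA.
- by move=> *; rewrite addrC.
- by move=> *; rewrite add0r.
- by move=> *; rewrite addNr.
- move=> a b c []; rewrite !polpiE ?starM (rep_mul hrho) counitM bopD bopZ.
  + by rewrite scalerDr scalerA addrA [counit (star (polpi b)) * _]mulrC.
  + by rewrite scalerDr scalerA addrA [counit (polpi b) * _]mulrC.
- move=> a []; rewrite ?bop0 ?scaler0 !polpiE ?star1 ?(rep_one hrho) ?counit1.
  + by rewrite scale1r add0r.
  + by rewrite addr0.
- move=> a []; rewrite ?bop0 ?scaler0 !polpiE ?star1 ?(rep_one hrho) ?counit1.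
  + by rewrite addr0.
  + by rewrite scale1r add0r.
- move=> a b c []; rewrite !polpiE ?starD ?(repD hrho) ?bopD ?counitD.
  + by rewrite scalerDl addrACA.
  + by rewrite scalerDr addrACA.
- move=> a b c []; rewrite !polpiE ?starD ?(repD hrho) ?bopD ?counitD.
  + by rewrite scalerDr addrACA.
  + by rewrite scalerDl addrACA.
- by move=> x y a []; rewrite scalerA ?rmorphM.
- by move=> a []; rewrite ?rmorph1 scale1r.
- by move=> x a b s; rewrite scalerDr.
- by move=> x y a []; rewrite ?rmorphD scalerDl.
- move=> x a b []; rewrite !polpiE scalerDr ?starZ ?(repZ hrho) ?bopZ ?counitZ.
  + by rewrite scalerA.
  + by rewrite !scalerA mulrC.
- move=> x a b []; rewrite !polpiE scalerDr ?starZ ?(repZ hrho) ?bopZ ?counitZ.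
  + by rewrite !scalerA mulrC.
  + by rewrite scalerA.
- by move=> a s; rewrite negbK.
- by move=> a b []; rewrite !polpiE ?starK.
- by move=> x a []; rewrite ?conjCK.
(* For [s = false] the [rho] terms sum to [- V j k] and the counit terms to [V j k]; for [s = true]
   the product is reversed and [j], [k] trade places. *)
- move=> j k s; rewrite cocycle_eval_sum cocycle_eval_delta.
  case: s => /=.
  + under eq_bigr do rewrite !polpiE starK star_gen.
    by rewrite big_split /= rowV sum_counit_genr addNr.
  + under eq_bigr do rewrite !polpiE star_gen.
    by rewrite big_split /= rowV sum_counit_genr addNr.
- move=> j k s; rewrite cocycle_eval_sum cocycle_eval_delta.
  case: s => /=.
  + under eq_bigr do rewrite !polpiE starK star_gen.
    by rewrite big_split /= colV sum_counit_genl addNr.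
  + under eq_bigr do rewrite !polpiE star_gen.
    by rewrite big_split /= colV sum_counit_genl addNr.
Qed.

Let eta (x : Pol C d) : H := cocycle_eval false (repr x).

Let etaE a : eta (polpi a) = cocycle_eval false a.
Proof. exact/cocycle_eval_cong/pcong_repr. Qed.

Let eta_linear : linear eta.
Proof.
move=> c; elim/polW=> a; elim/polW=> b.
by rewrite -polpiZ -polpiD !etaE.
Qed.

HB.instance Definition _ :=
  GRing.isLinear.Build C (Pol C d) H *:%R eta eta_linear.

(** By congruence invariance [cocycle_eval false] descends to the quotient, where the cocycle rule
    is its product clause. *)
Lemma cocycle_exists : exists f : {linear Pol C d -> H},
  is_cocycle rho (@counit C d) f /\ forall j k, f (u j k) = V j k.
Proof.
exists eta; split; last by move=> j k; rewrite -polpi_gen [LHS]etaE.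
by elim/polW=> a; elim/polW=> b; rewrite /= -polpiM !etaE.
Qed.

End Construction.
End Cocycle.

(** * The equivalence in matrix form *)

Theorem proposition3p7 (R : realType) (d : nat) (H : hilbertType R[i])
    (rho : Pol R[i] d -> bop H) (hrho : unital_star_rep rho)
    (V : 'M[H]_d) :
  let Rmx : 'M[bop H]_d := \matrix_(j, k) rho (gen_mx R[i] d j k) in
  (exists eta : {linear Pol R[i] d -> H},
      is_cocycle rho (@counit R[i] d) eta
      /\ V = \matrix_(j, k) eta (gen_mx R[i] d j k))
  <->
  ((op_mulmx (op_adjmx Rmx) V)^T = op_mulmx (op_conjmx Rmx) V^T
   /\ op_mulmx (op_conjmx Rmx) V^T = - V).
Proof.
move=> Rmx.
(* As the generators are self-adjoint, [op_conjmx Rmx] acts as [Rmx] and [op_adjmx Rmx] as its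
   transpose, which turns the matrix conditions into the row and column sums. *)
have adjR j k : adjoint (Rmx j k) =1 rho (gen_mx R[i] d j k).
  by move=> x; rewrite mxE (rep_adjoint hrho) star_gen.
have conjE j k : op_mulmx (op_conjmx Rmx) V^T j k
    = \sum_(p < d) rho (gen_mx R[i] d j p) (V k p).
  rewrite mxE; apply: eq_bigr => p _.
  by rewrite [op_conjmx _ _ _]mxE adjR [V^T _ _]mxE.
have adjE j k : (op_mulmx (op_adjmx Rmx) V)^T j k
    = \sum_(p < d) rho (gen_mx R[i] d p k) (V p j).
  by rewrite !mxE; apply: eq_bigr => p _; rewrite [op_adjmx _ _ _]mxE adjR.
split=> [[eta [etaP etaV]]|[adj_conj conj_V]].
  have VE j k : V j k = eta (gen_mx R[i] d j k) by rewrite etaV mxE.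
  have rowV j k : op_mulmx (op_conjmx Rmx) V^T j k = - V j k.
    rewrite conjE VE -(cocycle_row hrho etaP).
    by apply: eq_bigr => p _; rewrite VE.
  split; apply/matrixP=> j k; rewrite rowV; last by rewrite mxE.
  rewrite adjE VE -(cocycle_col hrho etaP).
  by apply: eq_bigr => p _; rewrite VE.
have [||eta [etaP etaV]] := @cocycle_exists _ _ _ _ hrho V.
- by move=> j k; rewrite -conjE conj_V mxE.
- by move=> j k; rewrite -adjE adj_conj conj_V mxE.
by exists eta; split=> //; apply/matrixP=> j k; rewrite mxE etaV.
Qed.
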